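(* Let $G$ be a finite group satisfying one of the following conditions: (i) $G$ is a metacyclic group; (ii) $M(G)=0$ or $M(G)\cong\mathbb{Z}/2\mathbb{Z}$, and $B_0(G)=0$. Then for any central extension $1\to C\to X\to G\to 1$ with $X$ a finite group, we have $B_0(X)=0$.
   Context: For a finite group $G$, the Bogomolov multiplier is $B_0(G)=\operatorname{Ker}\{H^2(G,\mathbb{Q}/\mathbb{Z})\to\bigoplus_A H^2(A,\mathbb{Q}/\mathbb{Z})\}$ (restriction maps, trivial action on $\mathbb{Q}/\mathbb{Z}$), where $A$ runs over all abelian subgroups of $G$. $M(G)=H_2(G,\mathbb{Z})$ is the Schur multiplier. A group is metacyclic if it is an extension $1\to N\to G\to H\to 1$ with $N$ and $H$ cyclic. The extension is central if the image of $C$ lies in the centre of $X$. In (ii) the condition $B_0(G)=0$ is required in both cases for $M(G)$. *)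

(* Defs.v *)
From HB Require Import structures.
From mathcomp Require Import all_boot all_order all_algebra.
From mathcomp Require Import all_fingroup all_solvable.
From mathcomp Require Import boolp.

Set Implicit Arguments.
Unset Strict Implicit.
Unset Printing Implicit Defensive.

Import GRing.Theory.
Local Open Scope ring_scope.
Local Open Scope quotient_scope.

(* repr also names the representative of a coset in fingroup. *)
Local Notation quot_repr := generic_quotient.repr.

Definition rat_int : {pred rat} := [pred x | x \is a Num.int].

Fact rat_int_zmod_closed : zmod_closed rat_int.
Proof. by split=> [|x y]; rewrite !inE; [exact: rpred0 | exact: rpredB]. Qed.
HB.instance Definition _ :=
  GRing.isZmodClosed.Build rat rat_int rat_int_zmod_closed.

Notation QmodZ := (Quotient.quot rat_int).

Section Homology.
Variables (U V W : zmodType) (f : {additive U -> V}) (g : {additive V -> W}).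

Definition ker_pred : {pred V} := [pred x | g x == 0].

Fact ker_pred_zmod_closed : zmod_closed ker_pred.
Proof.
split=> [|x y]; rewrite !inE ?raddf0 // => /eqP gx /eqP gy.
by rewrite raddfB gx gy subrr.
Qed.
HB.instance Definition _ :=
  GRing.isZmodClosed.Build V ker_pred ker_pred_zmod_closed.

Record kernel := Kernel { kernel_val : V; _ : kernel_val \in ker_pred }.
HB.instance Definition _ := [isSub for kernel_val].
HB.instance Definition _ := [Choice of kernel by <:].
HB.instance Definition _ := [SubChoice_isSubZmodule of kernel by <:].

Definition image_pred : {pred kernel} :=
  [pred x | `[< exists u, f u = val x >]].

Fact image_pred_zmod_closed : zmod_closed image_pred.
Proof.
split=> [|x y]; rewrite !inE; first by apply/asboolP; exists 0; rewrite !raddf0.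
move=> /asboolP[u fu] /asboolP[v fv]; apply/asboolP; exists (u - v).
by rewrite !raddfB fu fv.
Qed.
HB.instance Definition _ :=
  GRing.isZmodClosed.Build kernel image_pred image_pred_zmod_closed.

(* Every use below has g \o f = 0; since image_pred is a predicate on
   the kernel of g, the quotient makes sense without that hypothesis. *)
Definition homology := Quotient.quot image_pred.
HB.instance Definition _ := GRing.Zmodule.on homology.

Definition homology_class (x : kernel) : homology :=
  \pi_(Quotient.quot image_pred) x.

Lemma homology_class_eq0 (x : kernel) :
  homology_class x = 0 <-> exists u, f u = val x.
Proof.
rewrite -[0 in X in X <-> _](raddf0 \pi_(Quotient.quot image_pred)).
split=> [/eqP|fu]; last apply/eqP.
  by rewrite -Quotient.idealrBE subr0 inE => /asboolP.
by rewrite -Quotient.idealrBE subr0 inE; apply/asboolP.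
Qed.

End Homology.

Section HomologyMap.
Variables (U V W : zmodType) (f : {additive U -> V}) (g : {additive V -> W}).
Variables (U' V' W' : zmodType).
Variables (f' : {additive U' -> V'}) (g' : {additive V' -> W'}).
Variables (hU : {additive U -> U'}) (hV : {additive V -> V'}).
Variables (hW : {additive W -> W'}).
Hypothesis hf : forall u, hV (f u) = f' (hU u).
Hypothesis hg : forall v, hW (g v) = g' (hV v).

Fact kernel_map_subproof (x : kernel g) : hV (val x) \in ker_pred g'.
Proof.
case: x => x /= gx; move: (gx); rewrite !inE => /eqP gx0.
by rewrite -hg gx0 raddf0.
Qed.

Definition kernel_map (x : kernel g) : kernel g' :=
  Kernel (kernel_map_subproof x).

Definition homology_map (x : homology f g) : homology f' g' :=
  homology_class f'
    (kernel_map (quot_repr (x : Quotient.quot (image_pred f (g := g))))).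

Lemma homology_map_class (x : kernel g) :
  homology_map (homology_class f x) = homology_class f' (kernel_map x).
Proof.
rewrite /homology_map /homology_class; set y := quot_repr _.
apply/eqP; rewrite -Quotient.idealrBE inE.
have /eqP := reprK (\pi_(Quotient.quot (image_pred f (g := g))) x).
rewrite -Quotient.idealrBE inE => /asboolP[u fu]; apply/asboolP.
by exists (hU u); rewrite -hf fu !raddfB.
Qed.

Fact homology_map_is_zmod_morphism : zmod_morphism homology_map.
Proof.
move=> x y; rewrite -[x]reprK -[y]reprK.
rewrite -raddfB -!/(homology_class f _) !homology_map_class.
rewrite /homology_class -raddfB; congr (\pi _).
by apply: val_inj; rewrite /= raddfB.
Qed.

End HomologyMap.

Fact bar_cancel (M : zmodType) (a b c d e h : M) :
  (a - b + c) - (a - d + e) + (b - d + h) - (c - e + h) = 0.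
Proof.
rewrite !opprD !opprK [LHS](AC (3*3*3*3)
  ((1*4)*(2*7)*(3*10)*(5*8)*(6*11)*(9*12))) /=.
by rewrite !subrr !addNr !addr0.
Qed.

(* Inhomogeneous cochains with values in M with trivial action. *)
Section Cohomology.
Variables (gT : finGroupType) (M : zmodType).

Definition coboundary1 (c : {ffun gT -> M}) : {ffun gT * gT -> M} :=
  [ffun u => c u.2 - c (u.1 * u.2)%g + c u.1].

Definition coboundary2 (c : {ffun gT * gT -> M}) :
    {ffun gT * gT * gT -> M} :=
  [ffun u => let: (x, y, z) := u in
     c (y, z) - c ((x * y)%g, z) + c (x, (y * z)%g) - c (x, y)].

Fact coboundary1_is_zmod_morphism : zmod_morphism coboundary1.
Proof.
by move=> b c; apply/ffunP=> u; rewrite !ffunE !opprD !opprK;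
  rewrite [RHS]addrACA; congr (_ + _); rewrite addrACA.
Qed.
HB.instance Definition _ := GRing.isZmodMorphism.Build
  {ffun gT -> M} {ffun gT * gT -> M} coboundary1 coboundary1_is_zmod_morphism.

Fact coboundary2_is_zmod_morphism : zmod_morphism coboundary2.
Proof.
move=> b c; apply/ffunP=> -[[x y] z]; rewrite !ffunE !opprD !opprK.
by rewrite [RHS]addrACA; congr (_ + _); rewrite [RHS]addrACA; congr (_ + _);
  rewrite addrACA.
Qed.
HB.instance Definition _ := GRing.isZmodMorphism.Build
  {ffun gT * gT -> M} {ffun gT * gT * gT -> M}
  coboundary2 coboundary2_is_zmod_morphism.

Lemma coboundary2_coboundary1 c : coboundary2 (coboundary1 c) = 0.
Proof.
apply/ffunP=> -[[x y] z]; rewrite !ffunE /= mulgA.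
exact: bar_cancel.
Qed.

Definition H2 := homology coboundary1 coboundary2.
HB.instance Definition _ := GRing.Zmodule.on H2.

End Cohomology.

Section Pullback.
Variables (aT gT : finGroupType) (M : zmodType).
Variable phi : {morphism [set: aT] >-> gT}.

Definition pullback1 (c : {ffun gT -> M}) : {ffun aT -> M} :=
  [ffun x => c (phi x)].

Definition pullback2 (c : {ffun gT * gT -> M}) : {ffun aT * aT -> M} :=
  [ffun u => c (phi u.1, phi u.2)].

Definition pullback3 (c : {ffun gT * gT * gT -> M}) :
    {ffun aT * aT * aT -> M} :=
  [ffun u => c (phi u.1.1, phi u.1.2, phi u.2)].

Fact pullback1_is_zmod_morphism : zmod_morphism pullback1.
Proof. by move=> b c; apply/ffunP=> u; rewrite !ffunE. Qed.
HB.instance Definition _ := GRing.isZmodMorphism.Build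
  {ffun gT -> M} {ffun aT -> M} pullback1 pullback1_is_zmod_morphism.

Fact pullback2_is_zmod_morphism : zmod_morphism pullback2.
Proof. by move=> b c; apply/ffunP=> u; rewrite !ffunE. Qed.
HB.instance Definition _ := GRing.isZmodMorphism.Build
  {ffun gT * gT -> M} {ffun aT * aT -> M}
  pullback2 pullback2_is_zmod_morphism.

Fact pullback3_is_zmod_morphism : zmod_morphism pullback3.
Proof. by move=> b c; apply/ffunP=> u; rewrite !ffunE. Qed.
HB.instance Definition _ := GRing.isZmodMorphism.Build
  {ffun gT * gT * gT -> M} {ffun aT * aT * aT -> M}
  pullback3 pullback3_is_zmod_morphism.

Fact pullback_coboundary1 (c : {ffun gT -> M}) :
  pullback2 (coboundary1 c) = coboundary1 (pullback1 c).
Proof. by apply/ffunP=> u; rewrite !ffunE /= morphM ?inE. Qed.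

Fact pullback_coboundary2 (c : {ffun gT * gT -> M}) :
  pullback3 (coboundary2 c) = coboundary2 (pullback2 c).
Proof. by apply/ffunP=> -[[x y] z]; rewrite !ffunE /= !morphM ?inE. Qed.

Definition H2_pullback : H2 gT M -> H2 aT M :=
  homology_map _ pullback_coboundary2.

Fact H2_pullback_is_zmod_morphism : zmod_morphism H2_pullback.
Proof. exact: homology_map_is_zmod_morphism pullback_coboundary1 _. Qed.
HB.instance Definition _ := GRing.isZmodMorphism.Build
  (H2 gT M) (H2 aT M) H2_pullback H2_pullback_is_zmod_morphism.

End Pullback.

Definition H2_restr (gT : finGroupType) (M : zmodType) (A : {group gT}) :
    H2 gT M -> H2 [subg A] M :=
  H2_pullback [morphism of sgval].
HB.instance Definition _ (gT : finGroupType) (M : zmodType) (A : {group gT}) :=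
  GRing.Additive.on (@H2_restr gT M A).

Definition B0 (gT : finGroupType) : {pred H2 gT QmodZ} :=
  [pred x | [forall A : {group gT}, abelian A ==> (H2_restr A x == 0)]].
Arguments B0 : clear implicits.

Fact B0_zmod_closed (gT : finGroupType) : zmod_closed (B0 gT).
Proof.
split=> [|x y]; rewrite !inE.
  by apply/'forall_implyP=> A _; rewrite raddf0.
move=> /'forall_implyP Bx /'forall_implyP By; apply/'forall_implyP=> A abA.
by rewrite raddfB /= (eqP (Bx A abA)) (eqP (By A abA)) subrr.
Qed.
HB.instance Definition _ (gT : finGroupType) :=
  GRing.isZmodClosed.Build (H2 gT QmodZ) (B0 gT) (@B0_zmod_closed gT).

(* A chain c stands for the formal sum of the elements i of I with
   multiplicities c i; boundary2 and boundary3 are the differentials of the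
   inhomogeneous bar complex with coefficients in the trivial module Z. *)
Definition basis_chain (I : finType) (i : I) : {ffun I -> int} :=
  [ffun j => (j == i)%:R].

Definition chain_extend (I J : finType) (F : I -> {ffun J -> int})
    (c : {ffun I -> int}) : {ffun J -> int} := \sum_i F i *~ c i.

Fact chain_extend_is_zmod_morphism (I J : finType) (F : I -> {ffun J -> int}) :
  zmod_morphism (@chain_extend I J F).
Proof.
move=> b c; rewrite /chain_extend -sumrB; apply: eq_bigr => i _.
by rewrite !ffunE mulrzBr.
Qed.
HB.instance Definition _ (I J : finType) (F : I -> {ffun J -> int}) :=
  GRing.isZmodMorphism.Build
  {ffun I -> int} {ffun J -> int} (@chain_extend I J F)
  (@chain_extend_is_zmod_morphism I J F).

Lemma chain_extend_basis (I J : finType) (F : I -> {ffun J -> int}) i :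
  chain_extend F (basis_chain i) = F i.
Proof.
rewrite /chain_extend (bigD1 i) //= big1 => [|j /negPf ij]; rewrite !ffunE.
  by rewrite eqxx mulr1z addr0.
by rewrite ij mulr0z.
Qed.

Section IntegralHomology.
Variable gT : finGroupType.

Definition boundary2 : {ffun gT * gT -> int} -> {ffun gT -> int} :=
  chain_extend (fun u =>
    basis_chain u.2 - basis_chain (u.1 * u.2)%g + basis_chain u.1).
HB.instance Definition _ := GRing.Additive.on boundary2.

Definition boundary3 : {ffun gT * gT * gT -> int} -> {ffun gT * gT -> int} :=
  chain_extend (fun u => let: (x, y, z) := u in
    basis_chain (y, z) - basis_chain ((x * y)%g, z)
    + basis_chain (x, (y * z)%g) - basis_chain (x, y)).
HB.instance Definition _ := GRing.Additive.on boundary3.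

Lemma boundary2_boundary3 c : boundary2 (boundary3 c) = 0.
Proof.
rewrite {1}/boundary3 {1}/chain_extend raddf_sum big1 // => -[[x y] z] _.
rewrite raddfMz !(raddfB, raddfD) /= /boundary2 !chain_extend_basis /=.
by rewrite mulgA bar_cancel mul0rz.
Qed.

Definition schur_multiplier := homology boundary3 boundary2.
HB.instance Definition _ := GRing.Zmodule.on schur_multiplier.

End IntegralHomology.

Definition zmod_isog (U V : zmodType) : Prop :=
  exists f : {additive U -> V}, bijective f.

Record central_extension (cT xT gT : finGroupType)
    (i : {morphism [set: cT] >-> xT}) (p : {morphism [set: xT] >-> gT}) :
    Prop := CentralExtension {
  central_extension_inj : ('injm i)%g;
  central_extension_exact : (i @* [set: cT] = 'ker p)%g;
  central_extension_surj : (p @* [set: xT] = [set: gT])%g;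
  central_extension_central : (i @* [set: cT] \subset 'Z([set: xT]))%g
}.

(* Main.v *)
From HB Require Import structures.
Require Import Defs.
From mathcomp Require Import all_boot all_order all_algebra.
From mathcomp Require Import all_fingroup all_solvable.
From mathcomp Require Import boolp.

(** A class in the Bogomolov multiplier of X is represented by a cocycle c with
    values in Q/Z which is symmetric on commuting pairs. Its finitely many
    values have a common denominator, so c is the factor set of a finite
    central extension f : E -> X, together with an injective character l of
    ker f ([cocycle_central_extension]). The class vanishes exactly when l
    extends to a homomorphism E -> Q/Z, and symmetry of c says that commuting
    elements of X lift to commuting elements of E; hence a commutator of E that
    lies in ker f is trivial.

    Let q : E -> G be the composite with X -> G, and K its kernel. The image of
    K in X is central, so by the lifting property K is central in E. Thus E is
    a central extension of G itself, and it remains to extend l from ker f to E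
    knowing only that ker f contains no nontrivial commutator of E.

    If G is metacyclic, E has an abelian normal subgroup L with cyclic quotient
    generated by the image of some b. Then the commutators [n, b], n in L, form
    a normal subgroup F with E / F abelian. So F meets ker f trivially, and l,
    seen as a character of the image of ker f in E / F, extends because Q/Z is
    injective ([metacyclic_character_extension]).

    In the second case let T be the image of the 2-cycles of G under the K-valued
    factor set of E. It is a quotient of the Schur multiplier of G, hence has at
    most one nontrivial element. If T meets ker f trivially, l extends to a
    character of K that is trivial on T; pushing the factor set along it gives a
    cocycle of G that vanishes on 2-cycles, hence a coboundary
    ([evaluate_cycles_eq0]), and the character extends to E. Otherwise T lies in
    ker f. Commutators of lifts of commuting elements of G lie in T, so they are
    trivial; then for any character of K extending l the pushed-out cocycle of G
    defines a class in the Bogomolov multiplier of G, which vanishes, and again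
    the character extends to E ([schur_le2_character_extension]). *)

Set Implicit Arguments.
Unset Strict Implicit.
Unset Printing Implicit Defensive.

Import GRing.Theory Num.Theory.
Local Open Scope ring_scope.

(** * Injectivity of the rationals modulo the integers *)

Definition QZ (q : rat) : QmodZ := (\pi_QmodZ q)%qT.

Fact QZ_is_zmod_morphism : zmod_morphism QZ.
Proof. exact: raddfB. Qed.
HB.instance Definition _ :=
  GRing.isZmodMorphism.Build rat QmodZ QZ QZ_is_zmod_morphism.

Lemma QZ_eq0 q : (QZ q == 0) = (q \is a Num.int).
Proof.
by rewrite -(raddf0 QZ) /QZ -Quotient.idealrBE subr0 inE.
Qed.

Lemma QZ_surj t : exists q, t = QZ q.
Proof. by exists (generic_quotient.repr t); rewrite /QZ reprK. Qed.

Lemma QmodZ_divisible (t : QmodZ) (d : int) :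
  d != 0 -> exists s : QmodZ, s *~ d = t.
Proof.
move=> d0; have [q ->] := QZ_surj t; exists (QZ (q / d%:~R)).
by rewrite -raddfMz -mulrzr divfK // intr_eq0.
Qed.

Lemma QmodZ_torsion (t : QmodZ) : exists n, t *+ n.+1 = 0.
Proof.
have [q ->] := QZ_surj t; exists `|denq q|.-1%N.
rewrite prednK ?absz_gt0 ?denq_neq0 // -raddfMn /=.
apply/eqP; rewrite QZ_eq0 -mulr_natr -[_%:R]/((`|denq q|%N)%:Z%:~R) absz_denq.
by rewrite -[X in X * _]divq_num_den divfK ?intr_eq0 ?denq_neq0.
Qed.

(** The subgroup of order n + 1 of Q/Z, parametrized by 'I_n.+1; it carries the
    values of a torsion cocycle and keeps the extension built from it finite. *)
Section CyclicSubgroup.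
Variable n : nat.

Definition frac (a : 'I_n.+1) : QmodZ := QZ (a%:R / n.+1%:R).

Lemma frac_natmul k : QZ (k%:R / n.+1%:R) = frac (inZp k).
Proof.
apply/eqP; rewrite /frac -subr_eq0 -raddfB QZ_eq0 /= -mulrBl.
by rewrite {1}(divn_eq k n.+1) natrD addrK natrM mulfK ?pnatr_eq0.
Qed.

Lemma fracD : {morph frac : a b / a + b}.
Proof.
move=> a b; rewrite -[frac (a + b)](frac_natmul (a + b)).
by rewrite natrD mulrDl raddfD.
Qed.

Lemma frac_eq0 a : frac a = 0 -> a = 0.
Proof.
move/eqP; rewrite QZ_eq0 => /intrP[m /eqP].
rewrite eq_sym -(inj_eq (mulIf (x := n.+1%:R) _)) ?pnatr_eq0 // divfK ?pnatr_eq0 //.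
rewrite -[n.+1%:R]/(n.+1%:Z%:~R) -intrM -[a%:R]/((nat_of_ord a)%:Z%:~R) eqr_int => /eqP E.
apply/val_inj => /=; case: m E => m.
  rewrite -PoszM => -[E]; have := ltn_ord a; rewrite -E.
  by case: m {E} => // m; rewrite mulSn ltnNge leq_addr.
by rewrite NegzE mulNr.
Qed.

Lemma frac0 : frac 0 = 0.
Proof. by apply: (@addrI _ (frac 0)); rewrite -fracD !addr0. Qed.

Lemma fracN a : frac (- a) = - frac a.
Proof. by apply/eqP; rewrite -addr_eq0 -fracD addNr frac0. Qed.

Lemma torsion_frac t : t *+ n.+1 = 0 -> exists a, t = frac a.
Proof.
have [q ->] := QZ_surj t; rewrite -raddfMn /= => /eqP; rewrite QZ_eq0 => /intrP[m E].
exists (inZp `|(m %% n.+1)%Z|%N); rewrite -frac_natmul; apply/eqP.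
rewrite -subr_eq0 -raddfB QZ_eq0 /=.
rewrite -[_%:R in X in _ - X / _]/((`|(m %% n.+1)%Z|%N)%:Z%:~R) gez0_abs ?modz_ge0 //.
have -> : q = m%:~R / n.+1%:R by rewrite -E -[q *+ _]mulr_natr mulfK ?pnatr_eq0.
rewrite -mulrBl -intrB {1}(divz_eq m n.+1) addrK intrM -[n.+1%:~R]/(n.+1%:R).
by rewrite mulfK ?pnatr_eq0.
Qed.
End CyclicSubgroup.

Section Injective.
Variable V : zmodType.
Implicit Type R : V -> QmodZ -> Prop.

(** R is the graph of a homomorphism defined on a subgroup of V. Working with
    graphs lets the domain grow without changing types. *)
Definition partial_hom R :=
  [/\ R 0 0, (forall u v s t, R u s -> R v t -> R (u - v) (s - t))
    & forall t, R 0 t -> t = 0].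

Lemma partial_homMz R u s k : partial_hom R -> R u s -> R (u *~ k) (s *~ k).
Proof.
move=> [R0 RB _] Rus.
have RN v t : R v t -> R (- v) (- t) by move/(RB _ _ _ _ R0); rewrite !sub0r.
have RD v w t r : R v t -> R w r -> R (v + w) (t + r).
  by move=> Rv /RN/(RB _ _ _ _ Rv); rewrite !opprK.
have Rn n : R (u *+ n) (s *+ n).
  by elim: n => [|n IH]; rewrite ?mulr0n // !mulrS; apply: RD.
by case: k => n; [exact: Rn | exact: RN].
Qed.

(** The multiples of v in the domain of R form an ideal of Z; if d generates it
    and R sends d v to s, divisibility of Q/Z gives r with d r = s, and v can be
    sent to r. *)
Lemma partial_hom_step R v : partial_hom R ->
  exists R', [/\ partial_hom R', forall u s, R u s -> R' u s
    & exists t, R' v t].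
Proof.
move=> hR; have [R0 RB R1] := hR.
have [d [s [Rds dP]]] : exists d s, R (v *~ d) s /\
    forall k t, R (v *~ k) t -> (d %| k)%Z.
  (* d is the least positive n with n v in the domain, or 0 if there is none. *)
  pose P n := `[< (0 < n)%N /\ exists s, R (v *+ n) s >].
  have [exP|nexP] := pselect (exists n, P n); last first.
    exists 0, 0; rewrite mulr0z; split=> // k t Rk; rewrite dvd0z.
    case: k Rk => [[//|n]|n] Rk; case: nexP; exists n.+1; apply/asboolP;
      split=> //; first by exists t.
    by exists (- t); have := RB _ _ _ _ R0 Rk; rewrite NegzE mulrNz !sub0r opprK.
  case: (ex_minnP exP) => d /asboolP[d0 [s Rds]] dmin; exists d, s; split=> // k t Rk.
  have {}Rds : R (v *~ d%:Z) s by [].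
  have Rm : R (v *~ (k %% d)%Z) (t - s *~ (k %/ d)%Z).
    have := RB _ _ _ _ Rk (partial_homMz (k %/ d)%Z hR Rds).
    by rewrite -mulrzA -mulrzBr {1}(divz_eq k d) [d%:Z * _]mulrC addrC addKr.
  apply/dvdz_mod0P/eqP; apply: contraT => m0.
  have mge0 : 0 <= (k %% d)%Z by rewrite modz_ge0 // -lt0n.
  have : P `|(k %% d)%Z|%N.
    apply/asboolP; rewrite absz_gt0; split=> //.
    by exists (t - s *~ (k %/ d)%Z); rewrite pmulrn gez0_abs.
  move/dmin; rewrite leqNgt -ltz_nat gez0_abs //.
  by rewrite ltz_pmod // ltz_nat.
have [r rd] : exists r, r *~ d = s.
  have [d0|] := eqVneq d 0; last exact: QmodZ_divisible.
  by exists 0; rewrite mul0rz; apply/esym/R1; rewrite d0 mulr0z in Rds.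
exists (fun u t => exists k, R (u - v *~ k) (t - r *~ k)); split.
- split; first by exists 0; rewrite !mulr0z !subr0.
    move=> u w p q [k Rk] [l Rl]; exists (k - l).
    have subACA (M : zmodType) (a b c d' : M) :
      a - b - (c - d') = (a - c) - (b - d').
      by rewrite !opprD !opprK addrACA.
    rewrite !mulrzBr (subACA _ u) (subACA _ p).
    exact: RB.
  move=> t [k Rk]; have /dvdzP[m km] : (d %| - k)%Z.
    by apply: (dP _ (t - r *~ k)); rewrite mulrNz -sub0r.
  have := RB _ _ _ _ Rk (partial_homMz m hR Rds).
  rewrite sub0r -mulrNz km mulrC mulrzA subrr => /R1/eqP.
  by rewrite -rd -mulrzA [d * m]mulrC -km mulrNz opprK subrK => /eqP.
- by move=> u t Ru; exists 0; rewrite !mulr0z !subr0.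
- by exists r, 1; rewrite !mulr1z !subrr.
Qed.

(** Stated as an induction principle, so that the subgroup generated by vs need
    not be constructed. *)
Definition generates (vs : seq V) := forall P : V -> Prop,
  P 0 -> (forall u v, P u -> P v -> P (u - v)) ->
  (forall v, v \in vs -> P v) -> forall v, P v.

(** Injectivity of Q/Z for finitely generated groups, where adjoining the
    generators one at a time replaces an appeal to Zorn's lemma. *)
Lemma partial_hom_extend R (vs : seq V) : generates vs -> partial_hom R ->
  exists e : {additive V -> QmodZ}, forall v t, R v t -> e v = t.
Proof.
move=> gen hR.
have [R' [hR' sRR' tot]] : exists R', [/\ partial_hom R',
    forall u s, R u s -> R' u s & forall v, v \in vs -> exists t, R' v t].
  elim: vs {gen} R hR => [|v vs IH] R hR; first by exists R.
  have [R1 [hR1 sRR1 [t R1v]]] := partial_hom_step v hR.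
  have [R2 [hR2 sR12 tot]] := IH _ hR1; exists R2; split=> // [u s /sRR1/sR12 //|u].
  by rewrite inE => /predU1P[->|/tot //]; exists t; apply: sR12.
have [R0 RB R1] := hR'.
have {}tot v : exists t, R' v t.
  move: v; apply: gen => //; first by exists 0.
  by move=> u v [s Rs] [t Rt]; exists (s - t); apply: RB.
have uniq v s t : R' v s -> R' v t -> s = t.
  by move=> Rs Rt; apply/eqP; rewrite -subr_eq0; apply/eqP/R1; rewrite -(subrr v); apply: RB.
have [e eP] := choice tot.
have eB : zmod_morphism e by move=> u v; apply: uniq (eP _) (RB _ _ _ _ _ _).
pose eZ := GRing.isZmodMorphism.Build V QmodZ e eB.
pose ea : {additive V -> QmodZ} := HB.pack e eZ.
by exists ea => v t /sRR'; apply: uniq (eP v).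
Qed.
End Injective.

(** * Chains and cocycles *)

(** An abelian subgroup in additive notation, so that its elements can serve as
    coefficients of cochains. *)
Definition additive_group (gT : finGroupType) (A : {group gT}) of abelian A :=
  [subg A].

Section AdditiveGroup.
Variables (gT : finGroupType) (A : {group gT}) (abA : abelian A).
Local Notation addA := (additive_group abA).

HB.instance Definition _ := Finite.on addA.

Fact additive_group_addA : associative (fun x y : addA => (x * y)%g).
Proof. exact: mulgA. Qed.
Fact additive_group_addC : commutative (fun x y : addA => (x * y)%g).
Proof. by move=> x y; apply: val_inj; exact: (centsP abA _ (valP x) _ (valP y)). Qed.
Fact additive_group_add0 : left_id (1 : [subg A])%g (fun x y : addA => (x * y)%g).
Proof. exact: mul1g. Qed.
Fact additive_group_addN :
  left_inverse (1 : [subg A])%g (fun x : addA => x^-1)%g (fun x y : addA => (x * y)%g).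
Proof. exact: mulVg. Qed.

HB.instance Definition _ := GRing.isZmodule.Build addA
  additive_group_addA additive_group_addC additive_group_add0 additive_group_addN.

Definition to_additive (x : gT) : addA := subg A x.

Lemma to_additiveM : {in A &, {morph to_additive : x y / (x * y)%g >-> x + y}}.
Proof. exact: morphM. Qed.

Lemma to_additive1 : to_additive 1%g = 0.
Proof. exact: morph1. Qed.

Lemma to_additive_inj : {in A &, injective to_additive}.
Proof.
move=> x y Ax Ay E.
by rewrite -[x](@subgK _ A) // -[y](@subgK _ A) //; congr sgval.
Qed.

Lemma to_additive_surj (v : addA) : exists2 x, x \in A & v = to_additive x.
Proof. by exists (sgval v); [exact: subgP | rewrite /to_additive sgvalK]. Qed.
End AdditiveGroup.

Section CharacterOn.
Variables (gT : finGroupType) (A : {group gT}) (M : zmodType) (l : gT -> M).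
Hypothesis lM : {in A &, {morph l : x y / (x * y)%g >-> x + y}}.

Lemma morph_on1 : l 1%g = 0.
Proof. by apply: (@addrI _ (l 1%g)); rewrite -lM ?group1 // mulg1 addr0. Qed.

Lemma morph_onV : {in A, {morph l : x / x^-1%g >-> - x}}.
Proof.
move=> x Ax; apply/eqP.
by rewrite -addr_eq0 -lM ?groupV // mulVg morph_on1.
Qed.
End CharacterOn.

Lemma generates_finite (V : zmodType) (vs : seq V) :
  (forall v, v \in vs) -> generates vs.
Proof. by move=> tot P _ _ + v; apply. Qed.

Lemma generates_additive (gT : finGroupType) (A : {group gT}) (abA : abelian A) :
  generates [seq to_additive abA x | x <- enum A].
Proof.
apply: generates_finite => v; have [x Ax ->] := to_additive_surj v.
by apply: map_f; rewrite mem_enum.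
Qed.

Lemma chain_basis (I : finType) (u : {ffun I -> int}) :
  u = \sum_i basis_chain i *~ u i.
Proof.
apply/ffunP=> j; rewrite sum_ffunE.
have E i : (basis_chain i *~ u i) j = (j == i)%:R * u i.
  by rewrite -mulrzz; case: (u i) => n; rewrite /intmul ?ffunE ffunMnE ffunE.
rewrite (bigD1 j) //= big1 => [|i ij]; rewrite E ?eqxx ?mul1r ?addr0 //.
by rewrite eq_sym (negPf ij) mul0r.
Qed.

Lemma generates_chains (I : finType) :
  generates [seq basis_chain i | i <- enum I].
Proof.
move=> P P0 PB Pb u; rewrite [u]chain_basis.
have PN v : P v -> P (- v) by move/(PB _ _ P0); rewrite sub0r.
have PD v w : P v -> P w -> P (v + w) by move=> Pv /PN/(PB _ _ Pv); rewrite opprK.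
apply: (big_ind P) => // i _.
have Pn n : P (basis_chain i *+ n).
  elim: n => [|n IH]; rewrite ?mulr0n // mulrS; apply: PD => //.
  by apply: Pb; rewrite map_f ?mem_enum.
by case: (u i) => n; [exact: Pn | exact/PN/Pn].
Qed.

Definition evaluate (I : finType) (M : zmodType) (c : {ffun I -> M})
  (u : {ffun I -> int}) : M := \sum_i c i *~ u i.

Section Evaluate.
Variables (I : finType) (M : zmodType).
Implicit Type c : {ffun I -> M}.

Fact evaluate_is_zmod_morphism c : zmod_morphism (evaluate c).
Proof.
move=> u v; rewrite /evaluate -sumrB; apply: eq_bigr => i _.
by rewrite !ffunE mulrzBr.
Qed.
HB.instance Definition _ c := GRing.isZmodMorphism.Build _ _ (evaluate c)
  (evaluate_is_zmod_morphism c).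

Lemma evaluate_basis c i : evaluate c (basis_chain i) = c i.
Proof.
rewrite /evaluate (bigD1 i) //= big1 => [|j /negPf ij]; rewrite ffunE.
  by rewrite eqxx mulr1z addr0.
by rewrite ij mulr0z.
Qed.
End Evaluate.

Lemma evaluate_comp (I : finType) (M N : zmodType) (f : {additive M -> N})
  (c : {ffun I -> M}) u : evaluate [ffun i => f (c i)] u = f (evaluate c u).
Proof.
by rewrite raddf_sum; apply: eq_bigr => i _; rewrite ffunE raddfMz.
Qed.

Section Evaluation.
Variable gT : finGroupType.

Lemma evaluate_boundary3 (M : zmodType) (c : {ffun gT * gT -> M}) u :
  coboundary2 c = 0 -> evaluate c (boundary3 u) = 0.
Proof.
move/ffunP=> c0; rewrite raddf_sum big1 // => -[[x y] z] _.
rewrite raddfMz !(raddfB, raddfD) /= !evaluate_basis.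
by move: (c0 (x, y, z)); rewrite !ffunE => ->; rewrite mul0rz.
Qed.

(** The injective half of universal coefficients: such a c factors through the
    image of [boundary2], and by injectivity of Q/Z the resulting homomorphism
    extends to all 1-chains. *)
Lemma evaluate_cycles_eq0 (c : {ffun gT * gT -> QmodZ}) :
  (forall u, boundary2 u = 0 -> evaluate c u = 0) ->
  exists b : {ffun gT -> QmodZ}, coboundary1 b = c.
Proof.
move=> c0.
pose R v t := exists2 u, boundary2 u = v & evaluate c u = t.
have hR : partial_hom R.
  split; first by exists 0; rewrite raddf0.
    by move=> v w s t [u <- <-] [u' <- <-]; exists (u - u'); rewrite raddfB.
  by move=> t [u /c0 -> <-].
have [e eP] := partial_hom_extend (@generates_chains gT) hR.
exists [ffun g => e (basis_chain g)]; apply/ffunP=> u.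
rewrite !ffunE -(evaluate_basis c u) -(eP _ _ (ex_intro2 _ _ _ erefl erefl)).
by rewrite /boundary2 chain_extend_basis raddfD raddfB.
Qed.
End Evaluation.

(** * Characters, factor sets and central extensions *)

(** The multiplicative form of [partial_hom_extend]. The morphism f allows both
    inclusions and projections to a quotient as the map along which l extends. *)
Lemma abelian_character_extension (aT rT : finGroupType) (A : {group aT})
    (f : {morphism A >-> rT}) (B : {group rT}) (l : aT -> QmodZ) :
  abelian B -> (f @* A \subset B)%g ->
  {in A &, {morph l : x y / (x * y)%g >-> x + y}} ->
  {in A, forall a, f a = 1%g -> l a = 0} ->
  exists2 chi : rT -> QmodZ, {in B &, {morph chi : x y / (x * y)%g >-> x + y}}
    & {in A, forall a, chi (f a) = l a}.
Proof.
move=> abB sfB lM lf.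
have fB a : a \in A -> f a \in B.
  by move=> Aa; apply: (subsetP sfB); rewrite mem_morphim.
pose R (v : additive_group abB) t :=
  exists a, [/\ a \in A, to_additive abB (f a) = v & l a = t].
have hR : partial_hom R.
  split; first by exists 1%g; rewrite morph1 to_additive1 (morph_on1 lM).
    move=> u v s t [a [Aa <- <-]] [b [Ab <- <-]]; exists (a * b^-1)%g.
    rewrite groupM ?groupV // lM ?groupV // (morph_onV lM) // morphM ?groupV //.
    split=> //.
    apply/eqP; rewrite eq_sym subr_eq -to_additiveM ?groupM ?groupV ?fB ?groupV //.
    by rewrite morphV // mulgKV.
  move=> t [a [Aa fa <-]]; apply: lf => //.
  by apply: (@to_additive_inj _ _ abB); rewrite ?fB ?to_additive1.
have [e eR] := partial_hom_extend (@generates_additive _ _ abB) hR.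
exists (e \o to_additive abB) => [x y Bx By|a Aa] /=.
  by rewrite to_additiveM // raddfD.
by apply: eR; exists a.
Qed.

Lemma commuteMl (gT : finGroupType) (x y z : gT) :
  commute x z -> commute y z -> commute (x * y)%g z.
Proof.
by move=> xz yz; apply: commute_sym; apply: commuteM; apply: commute_sym.
Qed.

Section FactorSet.
Variables (eT gT : finGroupType) (q : {morphism [set: eT] >-> gT}) (s : gT -> eT).
Hypothesis (qs : cancel s q) (Kcentral : ('ker q \subset 'Z([set: eT]))%g).

Definition factor (x y : gT) : eT := (s x * s y * (s (x * y))^-1)%g.

Lemma factor_mulr x y : (s x * s y = factor x y * s (x * y))%g.
Proof. by rewrite mulgKV. Qed.

Lemma factor_ker x y : factor x y \in ('ker q)%g.
Proof. by apply/kerP; rewrite ?inE // !morphM ?inE // morphV ?inE // !qs mulgV. Qed.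

Lemma section_ker e : (e * (s (q e))^-1)%g \in ('ker q)%g.
Proof. by apply/kerP; rewrite ?inE // morphM ?morphV ?inE // qs mulgV. Qed.

Lemma ker_commute k e : k \in ('ker q)%g -> commute k e.
Proof.
by move=> /(subsetP Kcentral)/centerP[_ kC]; apply: kC; rewrite inE.
Qed.

(** Changing lifts by central elements does not affect whether they commute. *)
Lemma section_commute a b : commute (s (q a)) (s (q b)) -> commute a b.
Proof.
move=> ab; rewrite -(mulgKV (s (q a)) a) -(mulgKV (s (q b)) b).
have ka := section_ker a; have kb := section_ker b.
apply: commuteMl; first exact: ker_commute.
by apply: commuteM => //; apply: commute_sym; apply: ker_commute.
Qed.

Lemma factor_commute x y :
  commute x y -> factor x y = factor y x -> commute (s x) (s y).
Proof. by rewrite /commute => xy E; rewrite !factor_mulr E xy. Qed.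

Lemma factor_cocycle x y z :
  (factor x y * factor (x * y) z = factor y z * factor x (y * z))%g.
Proof.
apply: (mulIg (s (x * y * z))); rewrite -[LHS]mulgA -factor_mulr mulgA.
rewrite -factor_mulr -[RHS]mulgA -[in RHS](mulgA x y z) -factor_mulr [RHS]mulgA.
by rewrite (ker_commute _ (factor_ker _ _)) -[RHS]mulgA -factor_mulr mulgA.
Qed.

Variables (M : zmodType) (l : eT -> M).
Hypothesis lM : {in ('ker q)%g &, {morph l : x y / (x * y)%g >-> x + y}}.

Definition factor_cochain : {ffun gT * gT -> M} :=
  [ffun u => l (factor u.1 u.2)].

Lemma coboundary2_factor : coboundary2 factor_cochain = 0.
Proof.
apply/ffunP=> -[[x y] z]; rewrite !ffunE /=.
rewrite [X in X - _]addrAC -lM ?factor_ker // -factor_cocycle lM ?factor_ker //.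
by rewrite addrK subrr.
Qed.

(** A character of B extending l, composed with the section, bounds the cochain
    obtained from the factor set. The subgroup B allows restriction to the
    preimage of an abelian subgroup. *)
Lemma factor_coboundary (B : {group eT}) (chi : eT -> M) x y :
  {in B &, {morph chi : x y / (x * y)%g >-> x + y}} ->
  ('ker q \subset B)%g -> {in ('ker q)%g, chi =1 l} ->
  s x \in B -> s y \in B -> s (x * y)%g \in B ->
  chi (s y) - chi (s (x * y)%g) + chi (s x) = l (factor x y).
Proof.
move=> chiM sKB chil Bx By Bxy; have Kf := factor_ker x y.
rewrite addrAC -[RHS]chil //; apply/eqP; rewrite subr_eq addrC -!chiM //.
  by rewrite factor_mulr.
exact: (subsetP sKB).
Qed.

(** Every e is the product of the kernel element e s(q e)^-1 and of s(q e); the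
    extension is l on the first factor and b on the second. *)
Lemma coboundary_extension (b : {ffun gT -> M}) :
  coboundary1 b = factor_cochain ->
  exists2 chi : eT -> M, {morph chi : x y / (x * y)%g >-> x + y}
    & {in ('ker q)%g, chi =1 l}.
Proof.
move=> /ffunP bl.
have {}bl x y : b x + b y = l (factor x y) + b (x * y)%g.
  by have := bl (x, y); rewrite !ffunE /= => <-; rewrite addrAC subrK addrC.
exists (fun e => l (e * (s (q e))^-1)%g + b (q e)).
  move=> x y; rewrite morphM ?inE //.
  set kx := (x * (s (q x))^-1)%g; set ky := (y * (s (q y))^-1)%g.
  have Kx : kx \in ('ker q)%g := section_ker x.
  have Ky : ky \in ('ker q)%g := section_ker y.
  have -> : (x * y * (s (q x * q y))^-1 = kx * ky * factor (q x) (q y))%g.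
    have xE : (x = kx * s (q x))%g by rewrite mulgKV.
    have yE : (y = ky * s (q y))%g by rewrite mulgKV.
    rewrite {1}xE {1}yE /factor; move: kx ky Kx Ky {xE yE} => k1 k2 _ K2.
    by rewrite !mulgA -(mulgA k1 _ k2) -(ker_commute (s (q x)) K2) !mulgA.
  rewrite [RHS]addrACA bl (lM (groupM Kx Ky) (factor_ker _ _)) (lM Kx Ky).
  by rewrite -[LHS]addrA.
move=> k kk; have qk : q k = 1%g by apply/eqP; rewrite -(mker kk).
have := bl 1%g 1%g; rewrite mulg1 => /addIr b1.
rewrite qk b1 -lM ?factor_ker // ?groupM ?groupV //.
  by rewrite /factor mulg1 mulgK mulgKV.
by apply/kerP; rewrite ?inE ?qs.
Qed.

End FactorSet.

(** The central extension of xT by M with factor set c. As c need not be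
    normalized, the identity is (- c(1, 1), 1) and the coordinate of a kernel
    element is shifted by c(1, 1). *)
Section CocycleExtension.
Variables (M : finZmodType) (xT : finGroupType) (c : {ffun xT * xT -> M}).
Hypothesis hc : coboundary2 c = 0.

Fact cocycle_eq x y z : c (x, y) + c ((x * y)%g, z) = c (y, z) + c (x, (y * z)%g).
Proof.
have /ffunP/(_ (x, y, z)) := hc; rewrite !ffunE => /eqP.
by rewrite subr_eq0 addrAC subr_eq addrC => /eqP <-; rewrite addrC.
Qed.

Fact cocycle1l x : c (1%g, x) = c (1, 1)%g.
Proof. by apply/esym; have := cocycle_eq 1%g 1%g x; rewrite !mul1g => /addIr. Qed.

Fact cocycle1r x : c (x, 1%g) = c (1, 1)%g.
Proof. by have := cocycle_eq x 1%g 1%g; rewrite !mulg1 => /addIr. Qed.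

Definition cocycle_extension of coboundary2 c = 0 := (M * xT)%type.
Local Notation E := (cocycle_extension hc).
HB.instance Definition _ := Finite.on E.

Definition ext_mul (u v : E) : E := (u.1 + v.1 + c (u.2, v.2), (u.2 * v.2)%g).
Definition ext_one : E := (- c (1, 1)%g, 1%g).
Definition ext_inv (u : E) : E :=
  (- u.1 - c (u.2^-1, u.2)%g - c (1, 1)%g, u.2^-1%g).

Fact ext_mulA : associative ext_mul.
Proof.
move=> u v w; congr pair; rewrite /= ?mulgA //.
by rewrite [X in _ = X + _]addrAC -!addrA cocycle_eq.
Qed.
Fact ext_mul1 : left_id ext_one ext_mul.
Proof. by case=> a x; rewrite /ext_mul /= mul1g (cocycle1l x) addrAC addNr add0r. Qed.
Fact ext_mulV : left_inverse ext_one ext_inv ext_mul.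
Proof.
case=> a x; rewrite /ext_mul /ext_one /= mulVg; congr pair.
by rewrite addrAC [X in X + a]addrAC subrK addrAC addNr add0r.
Qed.
HB.instance Definition _ := Finite_isGroup.Build E ext_mulA ext_mul1 ext_mulV.

Definition ext_proj (u : E) : xT := u.2.
Fact ext_projM : {in [set: E] &, {morph ext_proj : u v / (u * v)%g}}.
Proof. by []. Qed.
Canonical ext_proj_morphism := Morphism ext_projM.

Definition ext_section (x : xT) : E := (0, x).
Definition ext_coord (u : E) : M := u.1 + c (1, 1)%g.

Lemma ext_sectionK : cancel ext_section ext_proj.
Proof. by []. Qed.

Lemma ext_kerP (u : E) : u \in ('ker ext_proj)%g -> u.2 = 1%g.
Proof. exact: mker. Qed.

Lemma ext_ker_central : ('ker ext_proj \subset 'Z([set: E]))%g.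
Proof.
apply/subsetP=> -[a x] /ext_kerP /= ->; apply/centerP; split; first by rewrite inE.
case=> b y _; congr pair; rewrite /= ?mulg1 ?mul1g //.
by rewrite cocycle1l cocycle1r [a + b]addrC.
Qed.

Lemma ext_coordM :
  {in ('ker ext_proj)%g &, {morph ext_coord : u v / (u * v)%g >-> u + v}}.
Proof.
move=> [a x] [b y] /ext_kerP /= -> /ext_kerP /= ->.
by rewrite /ext_coord /= addrACA !addrA.
Qed.

Lemma ext_coord_inj : {in ('ker ext_proj)%g, forall u, ext_coord u = 0 -> u = 1%g}.
Proof.
by move=> [a x] /ext_kerP /= -> /eqP; rewrite addr_eq0 => /eqP /= ->.
Qed.

Lemma ext_coord_factor x y :
  ext_coord (factor ext_section x y) = c (x, y).
Proof.
have /ext_kerP f1 := factor_ker ext_sectionK x y.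
have := factor_mulr ext_section x y.
move: f1; case: (factor _ x y) => a z /= -> [].
by rewrite !addr0 add0r (cocycle1l (x * y)%g) => ->.
Qed.
End CocycleExtension.

(** Replacing Q/Z by a finite cyclic subgroup containing all values of c makes
    the extension a finite group; l is the inclusion of that subgroup. *)
Lemma cocycle_central_extension (xT : finGroupType) (c : {ffun xT * xT -> QmodZ}) :
  coboundary2 c = 0 ->
  exists (eT : finGroupType) (p : {morphism [set: eT] >-> xT}) (s : xT -> eT)
      (l : eT -> QmodZ),
    [/\ cancel s p, ('ker p \subset 'Z([set: eT]))%g,
        {in ('ker p)%g &, {morph l : x y / (x * y)%g >-> x + y}},
        {in ('ker p)%g, forall k, l k = 0 -> k = 1%g}
      & factor_cochain s l = c].
Proof.
move=> hc.
have [n cn] : exists n, forall u, c u *+ n.+1 = 0.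
  have [m cm] := choice (fun u => QmodZ_torsion (c u)).
  exists (\prod_u (m u).+1).-1 => u; rewrite prednK ?prodn_gt0 //.
  by rewrite (bigD1 u) //= mulnC mulrnA mulrnAC cm mul0rn.
have [d dP] := choice (fun u => torsion_frac (cn u)).
pose c0 := [ffun u => d u].
have hc0 : coboundary2 c0 = 0.
  apply/ffunP=> -[[x y] z]; have /ffunP/(_ (x, y, z)) := hc.
  rewrite !ffunE !dP -!fracN -!fracD => /frac_eq0; exact.
exists (cocycle_extension hc0), (ext_proj_morphism hc0), (ext_section hc0).
exists (fun e => frac (ext_coord e)); split.
- exact: ext_sectionK.
- exact: ext_ker_central.
- by move=> u v ku kv; rewrite ext_coordM // fracD.
- by move=> u ku /frac_eq0/ext_coord_inj; apply.
- by apply/ffunP=> -[x y]; rewrite !ffunE ext_coord_factor dP ffunE.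
Qed.

(** * Central extensions of metacyclic groups *)

Section Commutators.
Local Open Scope group_scope.

(** On an abelian normal L the map n |-> [n, b] is a homomorphism. Its image F
    consists of commutators, is normalized by L and b, and L commutes with b
    modulo F. *)
Lemma abelian_by_cyclic_commutators (eT : finGroupType) (L : {group eT}) (b : eT) :
  abelian L -> L <| [set: eT] -> [set: eT] \subset L <*> <[b]> ->
  exists F : {group eT}, [/\ F <| [set: eT], abelian ([set: eT] / F)
    & {in F, forall f, exists m n, f = [~ m, n]}].
Proof.
move=> abL nL genE.
have nLx x y : x \in L -> x ^ y \in L.
  by move=> Lx; rewrite memJ_norm // (subsetP (normal_norm nL)) ?inE.
have nLR x y : x \in L -> [~ x, y] \in L.
  by move=> Lx; rewrite groupM ?groupV ?nLx.
have fM : {in L &, {morph (fun x => [~ x, b]) : x y / x * y}}.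
  move=> x y Lx Ly; rewrite /= commMgJ; congr (_ * _).
  by apply/conjg_fixP/commgP; apply: (centsP abL); rewrite ?nLR.
pose f := Morphism fM; pose F := (f @* L)%G.
have FP x : reflect (exists2 n, n \in L & x = [~ n, b]) (x \in F).
  by apply: (iffP morphimP) => [[n _ Ln ->]|[n Ln ->]]; exists n.
clearbody F; have sFL : F \subset L by apply/subsetP=> x /FP[n Ln ->]; exact: nLR.
have nF : [set: eT] \subset 'N(F).
  apply: subset_trans genE _; rewrite join_subG; apply/andP; split.
    by apply: cents_norm; apply: subset_trans abL (centS sFL).
  rewrite cycle_subG inE.
  apply/subsetP=> _ /imsetP[x /FP[n Ln ->] ->]; apply/FP; exists (n ^ b).
    exact: nLx.
  by rewrite conjRg [b ^ b]conjgE mulKg.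
exists F; split; first by rewrite /normal subsetT.
  apply: abelianS (quotientS F genE) _.
  have nFL : L \subset 'N(F) by apply: subset_trans nF; rewrite subsetT.
  have nFb : <[b]> \subset 'N(F) by apply: subset_trans nF; rewrite subsetT.
  rewrite quotientY // abelianY quotient_abelian //= quotient_abelian ?cycle_abelian //=.
  rewrite quotient_cycle -?cycle_subG // cycle_subG; apply/centP.
  move=> _ /morphimP[n Nn Ln ->]; apply: commute_sym; apply/commgP.
  rewrite -morphR // -?cycle_subG //=; apply/eqP/coset_id.
  by apply/FP; exists n.
by move=> x /FP[n _ ->]; exists n, b.
Qed.

Variables (eT gT : finGroupType) (q : {morphism [set: eT] >-> gT}) (s : gT -> eT).
Hypothesis (qs : cancel s q) (Kcentral : ('ker q \subset 'Z([set: eT]))%g).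

(** The preimage of a cyclic normal subgroup of G is generated by the central
    kernel and one more element, so it is abelian. *)
Lemma central_over_metacyclic_commutators : metacyclic [set: gT] ->
  exists F : {group eT}, [/\ F <| [set: eT], abelian ([set: eT] / F)
    & {in F, forall f, exists m n, f = [~ m, n]}].
Proof.
case/metacyclicP=> N [/cyclicP[a Na] nNG /cyclicP[b' Gb']].
have [b Nb cb] : exists2 b, b \in 'N(N) & coset N b = b'.
  have : b' \in [set: gT] / N by rewrite Gb' cycle_id.
  by case/morphimP=> b Nb _ ->; exists b.
pose L := (q @*^-1 N)%G.
have inL x : (x \in L) = (q x \in N) by rewrite !inE.
have kerL k x : k \in 'ker q -> commute k x by move/ker_commute; apply.
have LP x : x \in L -> exists k i, k \in 'ker q /\ x = k * s a ^+ i.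
  rewrite inL Na => /cycleP[i qx]; exists (x * (s a ^+ i)^-1), i.
  split; last by rewrite mulgKV.
  by apply/kerP; rewrite ?inE // morphM ?morphV ?morphX ?inE // qx qs mulgV.
apply: (@abelian_by_cyclic_commutators _ L (s b)).
- apply/centsP=> x /LP[k [i [Kk ->]]] y /LP[m [j [Km ->]]].
  apply: commuteMl; first exact: kerL.
  apply: commuteM; first by apply: commute_sym; apply: kerL.
  by apply: commuteX2.
- rewrite /normal subsetT; apply/subsetP=> x _; rewrite inE.
  apply/subsetP=> _ /imsetP[y Ly ->]; rewrite inL morphJ ?inE //.
  by rewrite memJ_norm -?inL // (subsetP (normal_norm nNG)) ?inE.
apply/subsetP=> x _.
have : coset N (q x) \in <[b']> by rewrite -Gb' mem_quotient ?inE.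
case/cycleP=> i; rewrite -cb -morphX // => E.
have Nx : q x \in 'N(N) by apply: (subsetP (normal_norm nNG)); rewrite inE.
have xN : q x * (b ^+ i)^-1 \in N.
  apply: coset_idr; first by rewrite groupM ?groupV ?groupX.
  rewrite morphM ?morphV ?groupV ?groupX //.
  by apply/eqP; rewrite -eq_mulgV1; apply/eqP.
rewrite -(mulgKV (s b ^+ i) x); apply: groupM.
  by apply: (subsetP (joing_subl _ _)); rewrite inL morphM ?morphV ?morphX ?inE // qs.
by apply: (subsetP (joing_subr _ _)); exact: mem_cycle.
Qed.

End Commutators.

(** * Cohomological and homological hypotheses in terms of cochains *)

Definition coboundary_on (gT : finGroupType) (M : zmodType) (A : {group gT})
    (c : {ffun gT * gT -> M}) :=
  exists b : {ffun [subg A] -> M}, coboundary1 b = pullback2 [morphism of sgval] c.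

Lemma homology_class_surj (U V W : zmodType) (f : {additive U -> V})
    (g : {additive V -> W}) (h : homology f g) :
  exists k, h = homology_class f k.
Proof.
by exists (generic_quotient.repr (h : Quotient.quot (image_pred f (g := g))));
  rewrite /homology_class reprK.
Qed.

Lemma B0_class (gT : finGroupType)
    (k : kernel (@coboundary2 gT QmodZ)) :
  (homology_class (@coboundary1 gT QmodZ) k \in B0 gT) <->
  forall A : {group gT}, abelian A -> coboundary_on A (val k).
Proof.
split=> [/'forall_implyP kB A abA | kB].
  have := eqP (kB A abA); rewrite /H2_restr /H2_pullback.
  by rewrite (homology_map_class (@pullback_coboundary1 _ _ _ _)) => /homology_class_eq0.
apply/'forall_implyP=> A abA; apply/eqP; rewrite /H2_restr /H2_pullback.
by rewrite (homology_map_class (@pullback_coboundary1 _ _ _ _)); apply/homology_class_eq0/kB.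
Qed.

Lemma B0_trivialP (gT : finGroupType) : B0 gT =i pred1 0 <->
  forall c : {ffun gT * gT -> QmodZ}, coboundary2 c = 0 ->
    (forall A : {group gT}, abelian A -> coboundary_on A c) ->
    exists b, coboundary1 b = c.
Proof.
split=> [B00 c c0 cA | H x].
  have kc : c \in ker_pred (@coboundary2 gT QmodZ) by rewrite inE; apply/eqP.
  have /B0_class : forall A : {group gT}, abelian A -> coboundary_on A (val (Kernel kc)).
    exact: cA.
  by rewrite B00 => /eqP/homology_class_eq0.
apply/idP/idP => [|/eqP->]; last exact: rpred0.
have [k ->] := homology_class_surj x => /B0_class kA; apply/eqP/homology_class_eq0.
by apply: H kA; case: k => c /= /eqP.
Qed.

(** Such a c is a coboundary on the abelian subgroup generated by x and y, and
    b y - b (x y) + b x is symmetric there. *)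
Lemma coboundary_on_abelian_sym (gT : finGroupType) (M : zmodType)
    (c : {ffun gT * gT -> M}) x y :
  (forall A : {group gT}, abelian A -> coboundary_on A c) ->
  commute x y -> c (x, y) = c (y, x).
Proof.
move=> cA xy; pose A := (<[x]> <*> <[y]>)%G.
have abA : abelian A.
  by rewrite abelianY !cycle_abelian cent_cycle cycle_subG; apply/cent1P/commute_sym.
have Ax : x \in A by rewrite (subsetP (joing_subl _ _)) ?cycle_id.
have Ay : y \in A by rewrite (subsetP (joing_subr _ _)) ?cycle_id.
have [b /ffunP bc] := cA A abA.
have := bc (subg A x, subg A y); have := bc (subg A y, subg A x).
rewrite !ffunE /= !subgK // => <- <-.
rewrite -!(morphM (subg_morphism A)) //= xy.
by rewrite addrAC [RHS]addrAC [X in X - _]addrC.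
Qed.

(** Both hypotheses on the Schur multiplier are used through this consequence. *)
Lemma schur_multiplier_le2 (gT : finGroupType) :
  (forall m : schur_multiplier gT, m = 0) \/ zmod_isog (schur_multiplier gT) 'Z_2 ->
  forall m m' : schur_multiplier gT, m != 0 -> m' != 0 -> m = m'.
Proof.
case=> [M0 m m'|[f bij_f] m m']; first by rewrite (M0 m) eqxx.
have Z2 (z : 'Z_2) : z != 0 -> z = 1.
  by case: z => [[|[|[]]] //= lt2] _; apply: val_inj.
have f_inj := bij_inj bij_f.
by rewrite -!(raddf_eq0 _ f_inj) => /Z2 fm /Z2 fm'; apply: f_inj; rewrite fm fm'.
Qed.

(** Evaluation of a cocycle on cycles factors through the Schur multiplier, so
    it takes at most one nonzero value. *)
Lemma evaluate_cycles_unique (gT : finGroupType) (M : zmodType)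
    (c : {ffun gT * gT -> M}) u v :
  (forall m m' : schur_multiplier gT, m != 0 -> m' != 0 -> m = m') ->
  coboundary2 c = 0 -> boundary2 u = 0 -> boundary2 v = 0 ->
  evaluate c u != 0 -> evaluate c v != 0 -> evaluate c u = evaluate c v.
Proof.
move=> M2 c0 u0 v0 cu cv.
have ku : u \in ker_pred (@boundary2 gT) by rewrite inE; apply/eqP.
have kv : v \in ker_pred (@boundary2 gT) by rewrite inE; apply/eqP.
pose cl w : schur_multiplier gT := homology_class (@boundary3 gT) w.
have cl_neq0 w : evaluate c (val w) != 0 -> cl w != 0.
  by apply: contraNneq => /homology_class_eq0[z <-]; rewrite evaluate_boundary3.
have /eqP := M2 _ _ (cl_neq0 (Kernel ku) cu) (cl_neq0 (Kernel kv) cv).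
rewrite -subr_eq0 /cl /homology_class -raddfB => /eqP/homology_class_eq0[z /= bz].
by apply/eqP; rewrite -subr_eq0 -raddfB /= -bz evaluate_boundary3.
Qed.

(** * The character attached to a class extends *)

(** The preimage B of an abelian subgroup of G is abelian because commuting
    elements lift to commuting elements. So l extends to B, and the cocycle is a
    coboundary on every abelian subgroup. *)
Lemma commuting_lifts_coboundary (eT gT : finGroupType)
    (q : {morphism [set: eT] >-> gT}) (s : gT -> eT) (l : eT -> QmodZ) :
  B0 gT =i pred1 0 -> cancel s q -> ('ker q \subset 'Z([set: eT]))%g ->
  {in ('ker q)%g &, {morph l : x y / (x * y)%g >-> x + y}} ->
  (forall g h, commute g h -> commute (s g) (s h)) ->
  exists b, coboundary1 b = factor_cochain s l.
Proof.
move=> /B0_trivialP B00 qs Kcentral lM lift; apply: B00.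
  exact: coboundary2_factor lM.
move=> A abA; pose B := (q @*^-1 A)%G.
have inB x : (x \in B) = (q x \in A) by rewrite !inE.
have sB a : a \in A -> s a \in B by rewrite inB qs.
have abB : abelian B.
  apply/centsP=> x Bx y By; apply: (section_commute qs Kcentral).
  by apply/lift/(centsP abA); rewrite -inB.
have sKB : ('ker q \subset B)%g by apply/subsetP=> k kk; rewrite inB (mker kk) group1.
have l1 := morph_on1 lM.
have [||chi chiM chil] := @abelian_character_extension _ _ ('ker q)%G
    (idm_morphism ('ker q)%G) B l abB _ lM.
- by rewrite morphim_idm.
- by move=> a _; rewrite /= /idm => ->.
exists [ffun a => chi (s (sgval a))]; apply/ffunP=> -[x y]; rewrite !ffunE /=.
by apply: (factor_coboundary qs chiM sKB chil); rewrite ?sB ?groupM ?subgP.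
Qed.

(** The subgroup F given by [central_over_metacyclic_commutators] consists of
    commutators, so it meets A trivially and A embeds in the abelian E / F. *)
Lemma metacyclic_character_extension (eT gT : finGroupType)
    (q : {morphism [set: eT] >-> gT}) (s : gT -> eT) (A : {group eT})
    (l : eT -> QmodZ) :
  metacyclic [set: gT] -> cancel s q -> ('ker q \subset 'Z([set: eT]))%g ->
  {in A &, {morph l : x y / (x * y)%g >-> x + y}} ->
  (forall m n, [~ m, n]%g \in A -> [~ m, n]%g = 1%g) ->
  exists2 chi : eT -> QmodZ, {morph chi : x y / (x * y)%g >-> x + y}
    & {in A, chi =1 l}.
Proof.
move=> metaG qs Kcentral lM comA.
have [F [nF abF Fcom]] := central_over_metacyclic_commutators qs Kcentral metaG.
have nFA : A \subset ('N(F))%g.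
  by apply: subset_trans (normal_norm nF); rewrite subsetT.
have l1 := morph_on1 lM.
have [||chi chiM chil] := @abelian_character_extension _ _ A
    (restrm_morphism nFA (coset_morphism F)) ([set: eT] / F)%G l abF _ lM.
- by rewrite /= morphim_restrm setIid; apply: morphimS; apply: subsetT.
- move=> a Aa /= /(coset_idr (subsetP nFA a Aa)) Fa.
  by have [m [n fE]] := Fcom a Fa; rewrite fE comA // -fE.
exists (chi \o coset F) => [x y|a Aa] /=; last exact: chil.
have nFx z : z \in ('N(F))%g by rewrite (subsetP (normal_norm nF)) ?inE.
by rewrite morphM // chiM // mem_quotient ?inE.
Qed.

(** It suffices to extend l to a character of K whose composite with the factor
    set of G is a coboundary. The two cases are whether or not A contains a
    nontrivial value of the factor set on a 2-cycle. *)
Lemma schur_le2_character_extension (eT gT : finGroupType)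
    (q : {morphism [set: eT] >-> gT}) (s : gT -> eT) (A : {group eT})
    (l : eT -> QmodZ) :
  (forall m m' : schur_multiplier gT, m != 0 -> m' != 0 -> m = m') ->
  B0 gT =i pred1 0 -> cancel s q -> ('ker q \subset 'Z([set: eT]))%g ->
  (A \subset 'ker q)%g ->
  {in A &, {morph l : x y / (x * y)%g >-> x + y}} ->
  (forall m n, [~ m, n]%g \in A -> [~ m, n]%g = 1%g) ->
  exists2 chi : eT -> QmodZ, {morph chi : x y / (x * y)%g >-> x + y}
    & {in A, chi =1 l}.
Proof.
move=> M2 B00 qs Kcentral sAK lM comA; pose K := ('ker q)%G.
have abK : abelian K.
  by apply: abelianS Kcentral (center_abelian _).
have l1 := morph_on1 lM.
suff [lam lamM [laml [b bE]]] : exists2 lam : eT -> QmodZ,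
    {in K &, {morph lam : x y / (x * y)%g >-> x + y}}
    & {in A, lam =1 l} /\ exists b, coboundary1 b = factor_cochain s lam.
  have [chi chiM chil] := coboundary_extension qs Kcentral lamM bE.
  by exists chi => // a Aa; rewrite chil ?laml // (subsetP sAK).
pose xi := factor_cochain s (to_additive abK).
have xiE g h : xi (g, h) = to_additive abK (factor s g h) by rewrite ffunE.
have xi0 : coboundary2 xi = 0.
  exact: (coboundary2_factor qs Kcentral (@to_additiveM _ _ abK)).
have [[u [a [u0 ua Aa]]]|noTA] := pselect (exists u a,
    [/\ boundary2 u = 0, evaluate xi u != 0 /\ evaluate xi u = to_additive abK a
      & a \in A]).
- have [||lam lamM laml] := @abelian_character_extension _ _ A
    (idm_morphism A) K l abK _ lM.
  + by rewrite morphim_idm.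
  + by move=> k _; rewrite /= /idm => ->.
  exists lam => //; split=> //; apply: commuting_lifts_coboundary => //.
  move=> g h gh; apply: (factor_commute gh).
  (* w is a cycle on which the factor set takes the value
     s g s h (s g)^-1 (s h)^-1; this is trivial or equal to a, hence lies in A. *)
  pose w := basis_chain (g, h) - basis_chain (h, g).
  have w0 : boundary2 w = 0.
    rewrite raddfB /= /boundary2 !chain_extend_basis /= gh.
    by apply/eqP; rewrite subr_eq0 addrAC [eqbRHS]addrAC [X in X - _]addrC.
  have wE : evaluate xi w = xi (g, h) - xi (h, g).
    by rewrite raddfB /= !evaluate_basis.
  have Kf := factor_ker qs.
  have [w00|wn0] := eqVneq (evaluate xi w) 0.
    apply: (@to_additive_inj _ _ abK); rewrite ?Kf // -!xiE.
    by apply/eqP; rewrite -subr_eq0 -wE w00.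
  case: ua => un0 ua.
  have := evaluate_cycles_unique M2 xi0 w0 u0 wn0 un0; rewrite ua wE => /eqP.
  have Ka : a \in K by apply: (subsetP sAK).
  rewrite subr_eq !xiE -to_additiveM ?Kf // => /eqP E0.
  have E : (factor s g h = a * factor s h g)%g.
    by apply: to_additive_inj E0; [exact: Kf | apply: groupM => //; exact: Kf].
  have aE : (a = [~ (s g)^-1, (s h)^-1])%g.
    apply: (mulIg (factor s h g)); rewrite -E /factor gh /commg /conjg !invgK.
    by rewrite !mulgA !mulgKV.
  by rewrite E aE comA ?mul1g -?aE.
(* R prescribes l on A and 0 on the values of the factor set on 2-cycles. It is
   single valued since A contains no such value other than 0. *)
pose R (v : additive_group abK) t := exists a u, [/\ a \in A, boundary2 u = 0,
  to_additive abK a + evaluate xi u = v & l a = t].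
have AK a : a \in A -> a \in K by move/(subsetP sAK).
have hR : partial_hom R.
  split; first by exists 1%g, 0; rewrite to_additive1 !raddf0 addr0 group1.
    move=> _ _ _ _ [a [u [Aa u0 <- <-]]] [b [v [Ab v0 <- <-]]].
    exists (a * b^-1)%g, (u - v); split.
    - by rewrite groupM ?groupV.
    - by rewrite raddfB /= u0 v0 subr0.
    - rewrite raddfB /= opprD addrACA; congr (_ + _).
      apply/eqP; rewrite eq_sym subr_eq -to_additiveM ?mulgKV //.
        by rewrite groupM ?groupV ?AK.
      exact: AK.
    - by rewrite lM ?groupV // (morph_onV lM).
  move=> t [a [u [Aa u0 /eqP au <-]]].
  suff -> : a = 1%g by [].
  apply: contra_notP noTA => a1; exists (- u), a.
  have E : evaluate xi (- u) = to_additive abK a.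
    by rewrite raddfN /=; apply/eqP; rewrite eq_sym -addr_eq0.
  split=> //; first by rewrite raddfN /= u0 oppr0.
  split=> //.
  apply: contra_not_neq a1; rewrite E -(to_additive1 abK).
  by apply: to_additive_inj; rewrite ?AK.
have [e eR] := partial_hom_extend (@generates_additive _ _ abK) hR.
exists (e \o to_additive abK) => [x y Kx Ky|] /=.
  by rewrite to_additiveM // raddfD.
split; first by move=> a Aa; apply: eR; exists a, 0; rewrite !raddf0 addr0.
apply: evaluate_cycles_eq0 => u u0.
have -> : factor_cochain s (e \o to_additive abK) = [ffun i => e (xi i)].
  by apply/ffunP=> i; rewrite !ffunE.
by rewrite evaluate_comp; apply: eR; exists 1%g, u; rewrite to_additive1 add0r.
Qed.

Theorem proposition6p8 (gT : finGroupType)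
    (hG : metacyclic [set: gT] \/
          (((forall m : schur_multiplier gT, m = 0%R) \/
            zmod_isog (schur_multiplier gT) 'Z_2) /\
           B0 gT =i pred1 0%R))
    (cT xT : finGroupType)
    (i : {morphism [set: cT] >-> xT}) (p : {morphism [set: xT] >-> gT})
    (hX : central_extension i p) :
  B0 xT =i pred1 0%R.
Proof.
apply/B0_trivialP => c c0 cA.
have [eT [f [s [l [fs Acentral lM l_inj cE]]]]] := cocycle_central_extension c0.
have [_ kerp surjp Cp] := hX.
have p_onto g : exists x, p x = g.
  have : g \in (p @* [set: xT])%g by rewrite surjp inE.
  by case/morphimP=> x _ _ ->; exists x.
have [t pt] := choice p_onto.
have fA k : (k \in ('ker f)%g) = (f k == 1%g) by rewrite !inE.
have lift a b : commute (f a) (f b) -> commute a b.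
  move=> ab; apply: (section_commute fs Acentral); apply: factor_commute => //.
  have Kf := factor_ker fs; apply/eqP; rewrite eq_mulgV1; apply/eqP.
  have lc x y : l (factor s x y) = c (x, y) by rewrite -cE ffunE.
  have Kfg : (factor s (f a) (f b) * (factor s (f b) (f a))^-1)%g \in ('ker f)%g.
    by apply: groupM; [|rewrite groupV]; exact: Kf.
  apply: l_inj => //; apply: (@addIr _ (l (factor s (f b) (f a)))).
  rewrite -(lM _ _ Kfg (Kf _ _)) mulgKV add0r !lc.
  exact: (coboundary_on_abelian_sym cA).
have qM : {in [set: eT] &, {morph p \o f : x y / (x * y)%g}}.
  by move=> x y _ _ /=; rewrite !morphM ?inE.
pose q := Morphism qM.
have qs : cancel (s \o t) q by move=> g; rewrite /= fs pt.
have Kcentral : ('ker q \subset 'Z([set: eT]))%g.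
  apply/subsetP=> k kk; apply/centerP; split=> [|e _]; rewrite ?inE //.
  apply: lift; have : f k \in ('Z([set: xT]))%g.
    by apply: (subsetP Cp); rewrite kerp; apply/kerP; [rewrite inE | exact: mker kk].
  by case/centerP=> _; apply; rewrite inE.
have sAK : ('ker f \subset 'ker q)%g.
  by apply/subsetP=> k kk; apply/kerP; rewrite ?inE //= (mker kk) morph1.
have comA m n : ([~ m, n] \in 'ker f -> [~ m, n] = 1)%g.
  rewrite fA morphR ?inE // => /commgP mn; apply/eqP/commgP; exact: lift.
have [chi chiM chil] : exists2 chi : eT -> QmodZ,
    {morph chi : x y / (x * y)%g >-> x + y} & {in ('ker f)%g, chi =1 l}.
  case: hG => [metaG|[/schur_multiplier_le2 M2 B00]].
    exact: metacyclic_character_extension qs Kcentral lM comA.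
  exact: schur_le2_character_extension qs Kcentral sAK lM comA.
exists [ffun x => chi (s x)]; rewrite -cE; apply/ffunP=> -[x y]; rewrite !ffunE /=.
by apply: (factor_coboundary fs (B := [set: eT]%G) _ _ chil);
  rewrite ?inE ?subsetT // => a b _ _; exact: chiM.
Qed.
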